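(* (1) Let $\mathfrak p=(p_m)_{m\ge1}$ be a converging sequence of positive-rooted polynomials, with $p_m$ of degree $m$. Then $\sqrt{\mathfrak p}:=(\mathbf S_m(p_m))_{m\ge1}$ is a converging sequence of even real-rooted polynomials, with $\rho(\sqrt{\mathfrak p})=S(\rho(\mathfrak p))$. (2) Let $\mathfrak q=(q_{2m})_{m\ge1}$ be a converging sequence of even real-rooted polynomials, with $q_{2m}$ of degree $2m$. Then $\mathfrak q^2:=(\mathbf Q_m(q_{2m}))_{m\ge1}$ is a converging sequence of positive-rooted polynomials, with $\rho(\mathfrak q^2)=Q(\rho(\mathfrak q))$.
   Context: All polynomials are monic. ''Positive-rooted'' means that all roots lie in $[0,\infty)$; ''real-rooted'' means all roots are real; a polynomial of even degree is even if $p(-x)=p(x)$. $\mathcal P_n$ denotes the monic polynomials of degree $n$ over $\mathbb C$, with coefficients $\mathsf e_k(p)$ defined by $p(x)=\sum_{k=0}^nx^{n-k}(-1)^k\mathsf e_k(p)$. $\mathbf S_m:\mathcal P_m\to\mathcal P_{2m}$ is $\mathbf S_m(p)(x)=p(x^2)$; $\mathbf Q_m:\mathcal P_{2m}\to\mathcal P_m$ is given by $\mathsf e_k(\mathbf Q_m(p))=(-1)^k\mathsf e_{2k}(p)$ for $0\le k\le m$ (so $p(x)=\mathbf Q_m(p)(x^2)$ for $p$ even). The empirical root distribution of a polynomial $p$ is $\rho(p)=\frac1{\deg p}\sum_{\alpha\text{ root of }p}\delta_\alpha$ (roots counted with multiplicity). A sequence $\mathfrak p=(p_{n_k})_{k\ge1}$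 of polynomials, with $n_k$ strictly increasing and $\deg p_{n_k}=n_k$, is converging if there is a probability measure $\rho(\mathfrak p)$ such that $\rho(p_{n_k})\to\rho(\mathfrak p)$ weakly as $k\to\infty$. For a symmetric probability measure $\mu$ on $\mathbb R$, $Q(\mu)$ is the pushforward of $\mu$ under $t\mapsto t^2$. For a probability measure $\nu$ on $[0,\infty)$, $S(\nu)=\frac12(S_+(\nu)+S_-(\nu))$, where $S_\pm(\nu)$ are the pushforwards of $\nu$ under $t\mapsto\pm\sqrt t$. *)

(* Defs.v *)
From HB Require Import structures.
From mathcomp Require Import all_boot all_order all_algebra.
From mathcomp Require Import all_classical all_reals all_analysis measurable_realfun.
From mathcomp Require Export complex.

Set Implicit Arguments.
Unset Strict Implicit.
Unset Printing Implicit Defensive.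

Import Order.TTheory GRing.Theory Num.Theory numFieldNormedType.Exports.

Local Open Scope classical_set_scope.
Local Open Scope ring_scope.
Local Open Scope complex_scope.

Section polynomials.
Variable R : realType.
Implicit Types p q : {poly R[i]}.

Definition monic_of_degree (n : nat) p : Prop := p \is monic /\ size p = n.+1.

Definition positive_rooted p : Prop := forall z : R[i], root p z -> 0 <= z.

Definition real_rooted p : Prop :=
  forall z : R[i], root p z -> z \is Num.real.

Definition even_polynomial p : Prop :=
  ~~ odd (size p).-1 /\ forall x : R[i], p.[- x] = p.[x].

(* [coef_e n p k] is e_k(p) for p in P_n, and [poly_of_e n e] is the element of
   P_n with e_k = e k, when e 0 = 1. *)
Definition coef_e (n : nat) p (k : nat) : R[i] := (-1) ^+ k * p`_(n - k).

Definition poly_of_e (n : nat) (e : nat -> R[i]) : {poly R[i]} :=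
  \sum_(k < n.+1) ((-1) ^+ k * e k) *: 'X^(n - k).

Definition S_poly p : {poly R[i]} := p \Po 'X^2.

Definition Q_poly (m : nat) p : {poly R[i]} :=
  poly_of_e m (fun k => (-1) ^+ k * coef_e (2 * m) p (2 * k)).

Definition complex_roots p : seq R[i] := sval (closed_field_poly_normal p).

(* The empirical root distribution, as a measure on the real line. It is only
   meant for real-rooted p, for which [complex.Re] is just the identification
   of the roots with elements of R. *)
Definition root_distribution p : set (measurableTypeR R) -> \bar R :=
  mscale ((size p).-1%:R^-1)%:nng
    (msum (fun i => \d_(complex.Re (complex_roots p)`_i : measurableTypeR R))
          (size (complex_roots p))).

HB.instance Definition _ p := Measure.on (root_distribution p).

End polynomials.

Section measures.
Variable R : realType.
Notation RR := (measurableTypeR R).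

Definition converges_weakly (mu_ : nat -> {measure set RR -> \bar R})
    (mu : {measure set RR -> \bar R}) : Prop :=
  forall f : R -> R, continuous f -> [bounded f x | x in [set: R]] ->
    (\int[mu_ k]_x (f x)%:E)%E @[k --> \oo] --> (\int[mu]_x (f x)%:E)%E.

Definition supported_on_nonneg (mu : probability RR R) : Prop :=
  mu [set x : RR | 0 <= (x : R)] = 1%E.

Definition symmetric_measure (mu : probability RR R) : Prop :=
  forall A : set RR, measurable A -> mu [set x : RR | A (- (x : R))] = mu A.

Definition sqr_fun (x : RR) : RR := (x : R) ^+ 2.
Definition sqrt_pos (x : RR) : RR := Num.sqrt (x : R).
Definition sqrt_neg (x : RR) : RR := - Num.sqrt (x : R).

Lemma measurable_sqr_fun : measurable_fun [set: RR] sqr_fun.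
Proof. exact: measurable_funX. Qed.

Lemma measurable_sqrt_pos : measurable_fun [set: RR] sqrt_pos.
Proof. exact: continuous_measurable_fun (@sqrt_continuous R). Qed.

Lemma measurable_sqrt_neg : measurable_fun [set: RR] sqrt_neg.
Proof. exact: measurableT_comp measurable_sqrt_pos. Qed.

HB.instance Definition _ := isMeasurableFun.Build _ _ _ _ sqr_fun
  measurable_sqr_fun.
HB.instance Definition _ := isMeasurableFun.Build _ _ _ _ sqrt_pos
  measurable_sqrt_pos.
HB.instance Definition _ := isMeasurableFun.Build _ _ _ _ sqrt_neg
  measurable_sqrt_neg.

Definition Q_measure (mu : probability RR R) : probability RR R :=
  distribution mu sqr_fun.

Section S_measure.
Variable nu : probability RR R.

(* Intended for nu supported on [0, +oo[: [Num.sqrt] is 0 on negative reals. *)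
Definition S_set_function : set RR -> \bar R :=
  mscale (2^-1)%:nng
    (measure_add (distribution nu sqrt_pos) (distribution nu sqrt_neg)).

HB.instance Definition _ := Measure.on S_set_function.

Lemma S_set_functionT : S_set_function [set: RR] = 1%E.
Proof.
rewrite /S_set_function /mscale [X in (_ * X)%E]measure_addE.
transitivity ((2^-1 : R)%:E * (1 + 1))%E.
  by congr (_ * (_ + _))%E; exact: probability_setT.
by rewrite -EFinD -EFinM -[1 + 1]/(2%:R) mulVf ?pnatr_eq0.
Qed.

HB.instance Definition _ :=
  Measure_isProbability.Build _ _ _ S_set_function S_set_functionT.

Definition S_measure : probability RR R := S_set_function.

End S_measure.
End measures.

(* The sequence is indexed by k >= 1; p k stands for p_{n_k}, and p 0 plays no
   role. *)
Definition converges_to (R : realType) (n : nat -> nat)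
    (p : nat -> {poly R[i]}) (mu : probability (measurableTypeR R) R) : Prop :=
  [/\ forall j k, (0 < j)%N -> (j < k)%N -> (n j < n k)%N,
      forall k, (0 < k)%N -> monic_of_degree (n k) (p k)
    & converges_weakly (fun k => root_distribution (p k)) mu].

(* Main.v *)
From HB Require Import structures.
Require Import Defs.
From mathcomp Require Import all_boot all_order all_algebra.
From mathcomp Require Import all_classical all_reals all_analysis.
From mathcomp Require Import measurable_realfun.

Import Order.TTheory GRing.Theory Num.Theory numFieldNormedType.Exports.

Local Open Scope classical_set_scope.
Local Open Scope ring_scope.
Local Open Scope complex_scope.

(** Everything rests on one identity. If p is monic with nonnegative roots, the
    roots of p(x^2) are the numbers sqrt r and - sqrt r, for r a root of p with
    its multiplicity ([complex_roots_S_poly]), so for every continuous f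
      int f d rho(S_m(p)) = int g d rho(p),
    where g(x) = (f(sqrt x) + f(- sqrt x)) / 2 ([sqrt_average],
    [integral_root_distribution_S_poly]). The same g satisfies
    int f d S(mu) = int g d mu ([integral_S_measure]), and g is continuous and
    bounded when f is. Testing the convergence of rho(p_m) against g gives the
    convergence of rho(S_m(p_m)) to S(mu).

    For an even real-rooted q of degree 2m, Q_m(q) is positive-rooted and
    q = S_m(Q_m(q)) ([S_poly_Q_poly]), so the same identity turns the integral
    of x |-> f(x^2) against rho(q) into that of f against rho(Q_m(q)): the
    convergence of rho(q_2m), tested against x |-> f(x^2), gives that of
    rho(Q_m(q_2m)) to Q(mu).

    The properties of the limit measures are also obtained by testing. The
    function min(1, max(0, -x)) has integral 0 against each rho(p_m), hence
    against mu, so that mu is carried by [0, +oo[. The functions f(-x) and f(x)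
    have the same integral against each rho(q_2m), hence against mu; as bounded
    continuous functions determine a probability measure
    ([eq_probability_bounded_continuous]), mu is symmetric. *)

(** * The roots of p(x^2) *)

Section Roots.
Context {R : realType}.
Implicit Types (p q : {poly R[i]}) (z : R[i]) (m n k : nat).

Lemma complex_roots_factor p :
  p = lead_coef p *: \prod_(z <- complex_roots p) ('X - z%:P).
Proof. by rewrite /complex_roots; case: closed_field_poly_normal. Qed.

Lemma mem_complex_roots p z :
  p != 0 -> (z \in complex_roots p) = root p z.
Proof.
move=> p0; rewrite {2}[p]complex_roots_factor rootZ ?lead_coef_eq0//.
by rewrite root_prod_XsubC.
Qed.

Lemma perm_complex_roots p (s : seq R[i]) :
  p = \prod_(z <- s) ('X - z%:P) -> perm_eq (complex_roots p) s.
Proof.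
move=> pE; apply: prod_XsubC_eq; rewrite -pE [RHS]complex_roots_factor.
by rewrite {2}pE lead_coef_prod_XsubC scale1r.
Qed.

Lemma monic_of_degree_neq0 n p : monic_of_degree n p -> p != 0.
Proof. by move=> [/monic_neq0]. Qed.

Lemma horner_S_poly p z : (S_poly p).[z] = p.[z ^+ 2].
Proof. by rewrite horner_comp hornerXn. Qed.

Lemma S_poly_monic_of_degree m p :
  monic_of_degree m p -> monic_of_degree (2 * m) (S_poly p).
Proof.
move=> [pm ps]; have p0 := monic_neq0 pm.
have sS : (size (S_poly p)).-1 = (2 * m)%N.
  by rewrite size_comp_poly size_polyXn ps mulnC.
have S0 : S_poly p != 0.
  by rewrite comp_poly_eq0 ?size_polyXn.
split; last by rewrite -sS prednK// lt0n size_poly_eq0.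
rewrite monicE lead_coef_comp ?size_polyXn// lead_coefXn expr1n mulr1.
by rewrite -monicE.
Qed.

Lemma S_poly_even_polynomial m p :
  monic_of_degree m p -> even_polynomial (S_poly p).
Proof.
move=> /S_poly_monic_of_degree[_ sS]; split; first by rewrite sS/= oddM.
by move=> x; rewrite !horner_S_poly sqrrN.
Qed.

Lemma sqr_ge0_real z : 0 <= z ^+ 2 -> z \is Num.real.
Proof.
move=> z2; have /eqP : z ^+ 2 = (sqrtC (z ^+ 2)) ^+ 2 by rewrite sqrtCK.
have r0 : sqrtC (z ^+ 2) \is Num.real by rewrite ger0_real// sqrtC_ge0.
by rewrite eqf_sqr => /orP[]/eqP ->; rewrite ?rpredN.
Qed.

Lemma S_poly_real_rooted p :
  positive_rooted p -> real_rooted (S_poly p).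
Proof.
move=> pp z; rewrite rootE horner_S_poly -rootE => /pp; exact: sqr_ge0_real.
Qed.

(** Each nonnegative root [z] of [p] gives the two roots [sqrt z] and
    [- sqrt z] of [p(x^2)], with multiplicities. *)
Lemma complex_roots_S_poly p : p \is monic -> positive_rooted p ->
  perm_eq (complex_roots (S_poly p))
    ([seq (Num.sqrt (complex.Re z))%:C | z <- complex_roots p] ++
     [seq - (Num.sqrt (complex.Re z))%:C | z <- complex_roots p]).
Proof.
move=> pm pp; apply: perm_complex_roots.
rewrite big_cat/= !big_map -big_split/= {1}[p]complex_roots_factor.
rewrite (monicP pm) scale1r /S_poly rmorph_prod/= !big_seq.
apply: eq_bigr => z; rewrite mem_complex_roots ?monic_neq0// => /pp z0.
rewrite comp_polyB comp_polyX comp_polyC polyCN opprK -subr_sqr -rmorphXn/=.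
congr (_ - _%:P); rewrite -rmorphXn/= sqr_sqrtr.
  by rewrite RRe_real// ger0_real.
by move: z0; rewrite lecE => /andP[].
Qed.


(** * Even polynomials as polynomials in x^2 *)

(** An even polynomial has no monomials of odd degree: [odd_poly q] vanishes at
    every nonzero square, hence at infinitely many points. *)
Lemma even_polynomial_odd_poly q : even_polynomial q -> odd_poly q = 0.
Proof.
move=> [_ qE].
have o0 z : z != 0 -> root (odd_poly q) z.
  move=> z0; pose w := sqrtC z.
  have w0 : w != 0 by rewrite sqrtC_eq0.
  have := qE w; rewrite -[X in X.[- w] = X.[w]]poly_even_odd !hornerE.
  rewrite !horner_comp !hornerXn sqrrN sqrtCK => /addrI/eqP.
  rewrite mulrN eq_sym -addr_eq0 -mulr2n mulrn_eq0 mulf_eq0 (negbTE w0) orbF.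
  by rewrite /= -rootE.
apply/eqP; apply: contraT => q0.
pose s := [seq (i.+1%:R : R[i]) | i <- iota 0 (size (odd_poly q))].
suff : (size s < size (odd_poly q))%N by rewrite size_map size_iota ltnn.
apply: max_poly_roots => //.
  by apply/allP => _ /mapP[i _ ->]; rewrite o0 ?pnatr_eq0.
rewrite map_inj_uniq ?iota_uniq// => i j /eqP.
by rewrite eqr_nat => /eqP[].
Qed.

(** The coefficients of [Q_poly m q] are those of [q] of even degree: the signs
    (-1)^k, (-1)^k and (-1)^(2k) cancel. *)
Lemma Q_polyE m q : size q = (2 * m).+1 -> Q_poly m q = even_poly q.
Proof.
move=> qs; rewrite (@even_polyE _ m.+1) ?qs; last by rewrite mul2n doubleS.
apply/polyP => j; rewrite coef_poly /Q_poly /poly_of_e coef_sum.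
have kE (k : 'I_m.+1) :
    ((-1) ^+ k * ((-1) ^+ k * coef_e (2 * m) q (2 * k))) = q`_((m - k).*2).
  rewrite /coef_e mulrA -exprD addnn -mul2n exprM sqrrN !expr1n mul1r.
  by rewrite mul1r -mulnBr mul2n.
under eq_bigr do rewrite kE coefZ coefXn.
case: ltnP => jm; last first.
  apply: big1 => k _; rewrite gtn_eqF ?mulr0// (leq_trans _ jm)// ltnS.
  exact: leq_subr.
have jm' : (m - j < m.+1)%N by rewrite ltnS leq_subr.
rewrite (bigD1 (Ordinal jm'))//= subKn// eqxx mulr1 big1 ?addr0// => k km.
case: eqP => [jE|]; last by rewrite mulr0.
by case/eqP: km; apply/val_inj; rewrite /= jE subKn// -ltnS.
Qed.

Lemma S_poly_Q_poly m q : even_polynomial q -> monic_of_degree (2 * m) q ->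
  S_poly (Q_poly m q) = q.
Proof.
move=> qe [_ qs]; rewrite Q_polyE// /S_poly -[RHS]poly_even_odd.
by rewrite even_polynomial_odd_poly// comp_poly0 mul0r addr0.
Qed.

Lemma Q_poly_monic_of_degree m q :
  even_polynomial q -> monic_of_degree (2 * m) q ->
  monic_of_degree m (Q_poly m q).
Proof.
move=> qe qd; have [qm qs] := qd.
have sQ : size (Q_poly m q) = m.+1.
  rewrite Q_polyE// size_even_poly_eq qs ?uphalfE mul2n ?oddS ?odd_double//=.
  by rewrite doubleK.
split=> //; rewrite monicE /lead_coef sQ Q_polyE// coef_even_poly.
by move: qm; rewrite monicE /lead_coef qs mul2n.
Qed.

Lemma Q_poly_positive_rooted m q : even_polynomial q ->
  monic_of_degree (2 * m) q -> real_rooted q -> positive_rooted (Q_poly m q).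
Proof.
move=> qe qd qr z; rewrite -[z]sqrtCK rootE -horner_S_poly S_poly_Q_poly//.
by rewrite -rootE => /qr zr; rewrite real_exprn_even_ge0.
Qed.

End Roots.

(** * Integrals of bounded continuous functions *)

Section Measures.
Context {R : realType}.
Notation RR := (measurableTypeR R).
Implicit Types (f g : R -> R) (p : {poly R[i]}).

Lemma continuous_measurable_RR f : continuous f ->
  measurable_fun [set: RR] (f : RR -> R).
Proof. exact: continuous_measurable_fun. Qed.

Lemma bounded_funP {T : Type} (f : T -> R) :
  [bounded f x | x in [set: T]] <-> exists M : R, forall x, `|f x| <= M.
Proof.
split=> [[M [_ fM]]|[M fM]].
  by exists (M + 1) => x; apply: fM => //; rewrite ltrDl.
exists M; split=> [|N MN x _]; first exact: num_real.
exact: le_trans (fM x) (ltW MN).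
Qed.

Lemma bounded_fun_comp {T : Type} f (g : T -> R) :
  [bounded f x | x in [set: R]] -> [bounded f (g x) | x in [set: T]].
Proof.
move=> /bounded_funP[M fM]; apply: (bounded_funP _).2; exists M => x.
exact: fM.
Qed.

Lemma integrable_bounded_continuous (mu : probability RR R) f :
  continuous f -> [bounded f x | x in [set: R]] ->
  mu.-integrable [set: RR] (EFin \o f).
Proof.
move=> cf bf; apply: measurable_bounded_integrable => //.
- by rewrite -ge0_fin_numE// fin_num_measure.
- exact: continuous_measurable_RR.
Qed.

Lemma integral_root_distribution p f :
  measurable_fun [set: RR] (f : RR -> R) ->
  (\int[root_distribution p]_x (f x)%:E =
   ((size p).-1%:R^-1 * \sum_(z <- complex_roots p) f (complex.Re z))%:E)%E.
Proof.
have ge0 g : (forall x, 0 <= g x) -> measurable_fun [set: RR] (g : RR -> R) ->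
  (\int[root_distribution p]_x (g x)%:E =
   ((size p).-1%:R^-1 * \sum_(z <- complex_roots p) g (complex.Re z))%:E)%E.
  move=> g0 mg; have mg' : measurable_fun [set: RR] (EFin \o g : RR -> \bar R).
    exact/measurable_EFinP.
  rewrite ge0_integral_mscale//=; last by move=> x _; rewrite lee_fin.
  rewrite ge0_integral_measure_sum//; last by move=> x _; rewrite lee_fin.
  rewrite EFinM (big_nth 0) big_mkord -sumEFin; congr (_ * _)%E.
  by apply: eq_bigr => i _; rewrite integral_dirac// diracT mul1e.
(* The general case follows by splitting f into positive and negative parts. *)
move=> mf; rewrite integralE.
rewrite (_ : (fun x => (f x)%:E) = EFin \o f)// funerpos funerneg /=.
rewrite !ge0//.
- rewrite -EFinB -mulrBr -sumrB; congr (_ * _)%:E; apply: eq_bigr => z _.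
  by have /(congr1 (@^~ (complex.Re z))) := funrposBneg f.
- exact: measurable_funrneg.
- exact: measurable_funrpos.
Qed.

Lemma integral_distribution_bounded (mu : probability RR R)
    (X : {RV mu >-> RR}) f : continuous f -> [bounded f x | x in [set: R]] ->
  (\int[distribution mu X]_x (f x)%:E = \int[mu]_x (f (X x))%:E)%E.
Proof.
move=> cf bf; rewrite integral_distribution//.
  by apply/measurable_EFinP; exact: continuous_measurable_RR.
apply: measurable_bounded_integrable => //.
- by rewrite -ge0_fin_numE// fin_num_measure.
- apply: (@measurableT_comp _ _ _ _ _ _ (f : RR -> R)) => //.
  exact: continuous_measurable_RR.
- exact: bounded_fun_comp.
Qed.

Lemma integral_mscale (mu : {measure set RR -> \bar R}) (k : {nonneg R})
    (f : RR -> \bar R) : mu.-integrable [set: RR] f ->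
  (\int[mscale k mu]_x f x = k%:num%:E * \int[mu]_x f x)%E.
Proof.
move=> fi; have mf := measurable_int _ fi.
rewrite integralE [in RHS]integralE !ge0_integral_mscale//=.
- by rewrite [RHS]muleBr//; exact: integrable_add_def.
- exact: measurable_funeneg.
- exact: measurable_funepos.
Qed.

(** The average of [f] over the two square roots of [x]: integrating it against
    [nu] amounts to integrating [f] against [S(nu)]. As [Num.sqrt] is 0 on
    negative numbers, it is constant, equal to [f 0], on ]-oo, 0], and it is
    continuous on the whole line when [f] is. *)
Definition sqrt_average f (x : R) : R :=
  (f (Num.sqrt x) + f (- Num.sqrt x)) / 2.

Lemma continuous_sqrtN : continuous (fun x : R => - Num.sqrt x).
Proof. by move=> x; apply: continuousN; exact: sqrt_continuous. Qed.

Lemma continuous_sqrt_average f : continuous f -> continuous (sqrt_average f).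
Proof.
move=> cf x; apply: cvgM; last exact: cvg_cst.
apply: cvgD; apply: continuous_comp; try exact: cf.
  exact: sqrt_continuous.
exact: continuous_sqrtN.
Qed.

Lemma bounded_sqrt_average f : [bounded f x | x in [set: R]] ->
  [bounded sqrt_average f x | x in [set: R]].
Proof.
move=> /bounded_funP[M fM]; apply: (bounded_funP _).2; exists M => x.
rewrite normrM normfV (ger0_norm (ler0n _ 2)) ler_pdivrMr ?ltr0n//.
by rewrite mulr_natr mulr2n (le_trans (ler_normD _ _))// lerD.
Qed.

Lemma integral_S_measure (mu : probability RR R) f :
  continuous f -> [bounded f x | x in [set: R]] ->
  (\int[S_measure mu]_x (f x)%:E = \int[mu]_x (sqrt_average f x)%:E)%E.
Proof.
move=> cf bf.
have half g : continuous g -> mu.-integrable [set: RR] (EFin \o (f \o g)).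
  move=> cg; apply: integrable_bounded_continuous.
    by move=> x; apply: continuous_comp; [exact: cg|exact: cf].
  exact: bounded_fun_comp _ g bf.
rewrite integral_mscale; last first.
  apply: measurable_bounded_integrable => //.
    rewrite [ltLHS]measure_addE lte_add_pinfty// -ge0_fin_numE//;
      exact: fin_num_measure.
  exact: continuous_measurable_RR.
rewrite integral_measure_add//; [|exact: integrable_bounded_continuous..].
rewrite !integral_distribution_bounded//.
under [in RHS]eq_integral do rewrite /sqrt_average mulrC EFinM EFinD.
have i1 := half _ (@sqrt_continuous R); have i2 := half _ continuous_sqrtN.
by rewrite integralZl ?integralD//; exact: integrableD.
Qed.

Lemma integral_root_distribution_S_poly m p f :
  monic_of_degree m p -> positive_rooted p -> continuous f ->
  (\int[root_distribution (S_poly p)]_x (f x)%:E =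
   \int[root_distribution p]_x (sqrt_average f x)%:E)%E.
Proof.
move=> pd pp cf; have [pm ps] := pd.
have [_ Ss] := S_poly_monic_of_degree _ _ pd.
rewrite !integral_root_distribution ?Ss ?ps/=.
- rewrite (perm_big _ (complex_roots_S_poly _ pm pp)) big_cat/= !big_map.
  rewrite -big_split/= -mulr_suml mulrCA mulrC natrM invfM; congr (_ * _)%:E.
  by rewrite mulrC.
- by apply: continuous_measurable_RR; exact: continuous_sqrt_average.
- exact: continuous_measurable_RR.
Qed.

(** * Measures determined by bounded continuous functions *)

(** For n > 0, the ramp equal to 1 on ]-oo, a], to 0 on [a + 1/n, +oo[, and
    affine between; it decreases to the indicator of ]-oo, a] as n tends to
    infinity. *)
Definition ramp (a : R) (n : nat) (x : R) : R :=
  Num.min 1 (Num.max 0 (1 - n%:R * (x - a))).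

Lemma continuous_ramp a n : continuous (ramp a n).
Proof.
pose l x := 1 - n%:R * (x - a).
move=> x; apply: (@continuous_min R R (cst 1) (cst 0 \max l)).
  exact: cvg_cst.
apply: (@continuous_max R R (cst 0) l); first exact: cvg_cst.
apply: cvgB; first exact: cvg_cst.
by apply: cvgM; [exact: cvg_cst|apply: cvgB; [exact: cvg_id|exact: cvg_cst]].
Qed.

Lemma ramp_le1 a n x : `|ramp a n x| <= 1.
Proof.
by rewrite ger0_norm /ramp ?ge_min ?lexx// le_min ler01 le_max lexx.
Qed.

Lemma bounded_ramp a n : [bounded ramp a n x | x in [set: R]].
Proof. by apply: (bounded_funP _).2; exists 1 => x; exact: ramp_le1. Qed.

Lemma cvg_ramp a x : ramp a n x @[n --> \oo] --> (\1_(`]-oo, a]%classic) x : R).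
Proof.
rewrite indicE mem_setE in_itv/=; have [xa|ax] := leP x a.
  rewrite [X in X @ _](_ : _ = cst 1); first exact: cvg_cst.
  apply/funext => n; rewrite /ramp min_l// le_max lerBrDr -lerBrDl subrr.
  by rewrite mulr_ge0_le0 ?orbT// subr_le0.
apply: cvg_near_cst; near=> n.
rewrite /ramp max_l ?min_r// subr_le0 -ler_pdivrMr ?subr_gt0//.
near: n; exact: nbhs_infty_ger.
Unshelve. all: by end_near.
Qed.

Lemma cvg_integral_ramp (mu : probability RR R) a :
  (\int[mu]_x (ramp a n x)%:E @[n --> \oo] --> mu `]-oo, a]%classic)%E.
Proof.
have -> : mu `]-oo, a]%classic =
    (\int[mu]_x (\1_(`]-oo, a]%classic) x : R)%:E)%E.
  by rewrite integral_indic// setIT.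
have [] // := @dominated_convergence _ _ R mu [set: RR] measurableT
  (fun n x => (ramp a n x)%:E) (fun x => (\1_(`]-oo, a]%classic) x : R)%:E)
  (cst 1%E).
- move=> n; apply/measurable_EFinP; apply: continuous_measurable_RR.
  exact: continuous_ramp.
- by apply/measurable_EFinP; exact: measurable_indic.
- by apply: aeW => x _; apply: cvg_EFin; [exact: nearW|exact: cvg_ramp].
- exact: finite_measure_integrable_cst.
- apply: aeW => x n _; rewrite lee_fin; exact: ramp_le1.
Qed.

(** A probability measure on the line is determined by the integrals of bounded
    continuous functions. *)
Lemma eq_probability_bounded_continuous (mu nu : probability RR R) :
  (forall f, continuous f -> [bounded f x | x in [set: R]] ->
    \int[mu]_x (f x)%:E = \int[nu]_x (f x)%:E)%E ->
  forall A, measurable A -> mu A = nu A.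
Proof.
move=> munu.
have cdfE a : mu `]-oo, a]%classic = nu `]-oo, a]%classic.
  have := cvg_integral_ramp nu a.
  have rampE n := munu _ (@continuous_ramp a n) (@bounded_ramp a n).
  under eq_fun do rewrite -rampE.
  exact: (cvg_unique _ (cvg_integral_ramp mu a)).
have itvE (P : probability RR R) a b : a <= b ->
    P `]a, b]%classic = (P `]-oo, b]%classic - P `]-oo, a]%classic)%E.
  move=> ab.
  have -> : `]a, b]%classic = `]-oo, b] `\` `]-oo, a].
    by rewrite -[RHS]setCK setCD setCitvl setUC -[LHS]setCK setCitv.
  rewrite measureD ?setIidr//; first exact: subset_itvl.
  by rewrite -ge0_fin_numE// fin_num_measure.
(* The intervals ]a, b] form a pi-system generating the Borel sets. *)
apply: (@measure_unique _ R RR (@ocitv R) (fun k => `]- k%:R, k%:R]%classic)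
  _ _ _ _ mu nu) => //.
- exact: ocitvI.
- by move=> i; exact: is_ocitv.
- exact: bigcup_itvT.
- move=> _ [[a b]/= _ <-]; have [ab|ba] := leP a b.
    by rewrite !itvE// !cdfE.
  by rewrite set_itv_ge ?measure0// bnd_simp -leNgt ltW.
- by move=> k; rewrite -ge0_fin_numE// fin_num_measure.
Qed.

(** [ramp (-1) 1] is [min(1, max(0, -x))], whose zeros are exactly the points
    of [0, +oo[. *)
Lemma ramp_eq0 x : (ramp (-1) 1 x == 0) = (0 <= x).
Proof.
rewrite /ramp mul1r opprK opprD addrCA subrr addr0.
have [x0|x0] := leP 0 x.
  by rewrite max_l ?oppr_le0// min_r// eqxx.
by rewrite gt_eqF// lt_min ltr01 lt_max oppr_gt0 x0 orbT.
Qed.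

Lemma supported_on_nonnegP (mu : probability RR R) :
  (\int[mu]_x (ramp (-1) 1 x)%:E = 0)%E -> supported_on_nonneg mu.
Proof.
move=> int0.
have mf : measurable_fun [set: RR] (EFin \o ramp (-1) 1 : RR -> \bar R).
  apply/measurable_EFinP; apply: continuous_measurable_RR.
  exact: continuous_ramp.
have /(ae_eq_integral_abs mu measurableT mf)[N [mN N0 NP]] :
    (\int[mu]_x `|(EFin \o ramp (-1) 1) x| = 0)%E.
  rewrite -int0; apply: eq_integral => x _ /=.
  by rewrite ger0_norm// /ramp le_min ler01 le_max lexx.
have mI : measurable (`]-oo, 0[%classic : set RR) by exact: measurable_itv.
have mu0 : mu (`]-oo, 0[%classic : set RR) = 0%E.
  apply: (subset_measure0 mI mN _ N0) => x /=.
  rewrite in_itv/= ltNge -ramp_eq0 => /eqP x0; apply: NP => /= r0.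
  by apply: x0; have [] := r0 I.
rewrite /supported_on_nonneg (_ : [set x | _] = ~` `]-oo, (0:R)[%classic).
  by rewrite probability_setC// mu0 sube0.
by apply/seteqP; split=> x /=; rewrite in_itv/= ltNge;
  [move=> -> | move/negP; rewrite negbK].
Qed.

(** The reflection of the line about the origin. *)
Definition reflection (x : RR) : RR := - (x : R).

Lemma measurable_reflection : measurable_fun [set: RR] reflection.
Proof. exact: oppr_measurable. Qed.

HB.instance Definition _ := isMeasurableFun.Build _ _ _ _ reflection
  measurable_reflection.

Lemma symmetric_measureP (mu : probability RR R) :
  (forall f, continuous f -> [bounded f x | x in [set: R]] ->
    \int[mu]_x (f (- x))%:E = \int[mu]_x (f x)%:E)%E ->
  symmetric_measure mu.
Proof.
move=> muN A mA.
apply: (eq_probability_bounded_continuous (distribution mu reflection)) => //.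
by move=> f cf bf; rewrite integral_distribution_bounded// muN.
Qed.

End Measures.
(** * Convergence of the root distributions *)

Theorem proposition6p1 (R : realType) :
  (forall (p : nat -> {poly R[i]}) (mu : probability (measurableTypeR R) R),
     (forall m, (0 < m)%N -> positive_rooted (p m)) ->
     converges_to (fun m => m) p mu ->
     [/\ supported_on_nonneg mu,
         forall m, (0 < m)%N ->
           even_polynomial (S_poly (p m)) /\ real_rooted (S_poly (p m))
       & converges_to (fun m => (2 * m)%N) (fun m => S_poly (p m))
           (S_measure mu)]) /\
  (forall (q : nat -> {poly R[i]}) (mu : probability (measurableTypeR R) R),
     (forall m, (0 < m)%N ->
        even_polynomial (q m) /\ real_rooted (q m)) ->
     converges_to (fun m => (2 * m)%N) q mu ->
     [/\ symmetric_measure mu,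
         forall m, (0 < m)%N -> positive_rooted (Q_poly m (q m))
       & converges_to (fun m => m) (fun m => Q_poly m (q m))
           (Q_measure mu)]).
Proof.
split=> [p mu pp [_ pd pmu]|q mu qP [_ qd qmu]].
- split=> [|m m0|]; last split.
  + have cr := @continuous_ramp R (-1) 1.
    have br := @bounded_ramp R (-1) 1.
    (* The test function vanishes at each root of p m. *)
    apply: supported_on_nonnegP; apply: cvg_unique (pmu _ cr br) _ => //.
    apply: cvg_near_cst; near=> m.
    have m0 : (0 < m)%N by near: m; exact: nbhs_infty_gt.
    rewrite integral_root_distribution; last exact: continuous_measurable_RR.
    rewrite big_seq big1 ?mulr0// => z.
    rewrite mem_complex_roots ?(monic_of_degree_neq0 _ _ (pd _ m0))// => zr.
    have := pp _ m0 _ zr; rewrite lecE => /andP[_ z0].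
    by apply/eqP; rewrite ramp_eq0.
  + by split; [exact: S_poly_even_polynomial (pd _ m0)|
               exact: S_poly_real_rooted (pp _ m0)].
  + by move=> j k _ jk; rewrite ltn_mul2l.
  + by move=> m m0; exact: S_poly_monic_of_degree (pd _ m0).
  + move=> f cf bf; rewrite integral_S_measure//.
    have := pmu _ (continuous_sqrt_average _ cf) (bounded_sqrt_average _ bf).
    apply: cvg_trans; apply: near_eq_cvg; near=> m.
    have m0 : (0 < m)%N by near: m; exact: nbhs_infty_gt.
    by rewrite (integral_root_distribution_S_poly _ _ _ (pd _ m0) (pp _ m0) cf).
have Qd m : (0 < m)%N -> monic_of_degree m (Q_poly m (q m)).
  by move=> m0; apply: Q_poly_monic_of_degree (qd _ m0); case: (qP _ m0).
have Qp m : (0 < m)%N -> positive_rooted (Q_poly m (q m)).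
  move=> m0; have [qe qr] := qP _ m0.
  exact: Q_poly_positive_rooted (qd _ m0) qr.
have qE m : (0 < m)%N -> q m = S_poly (Q_poly m (q m)).
  by move=> m0; rewrite S_poly_Q_poly//; [case: (qP _ m0)|exact: qd].
have qint f m : (0 < m)%N -> continuous f ->
    (\int[root_distribution (q m)]_x (f x)%:E =
     \int[root_distribution (Q_poly m (q m))]_x (sqrt_average f x)%:E)%E.
  move=> m0 cf; rewrite {1}qE//.
  exact: (integral_root_distribution_S_poly _ _ _ (Qd _ m0) (Qp _ m0) cf).
split=> //; last split=> //.
- apply: symmetric_measureP => f cf bf.
  have cfN : continuous (fun x => f (- x)).
    by move=> x; apply: continuous_comp; [exact: continuousN|exact: cf].
  have bfN := bounded_fun_comp _ (@GRing.opp R) bf.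
  apply: cvg_unique (qmu _ cfN bfN) _ => //.
  have := qmu _ cf bf; apply: cvg_trans; apply: near_eq_cvg; near=> m.
  have m0 : (0 < m)%N by near: m; exact: nbhs_infty_gt.
  (* [f] and its reflection have the same average over the square roots. *)
  rewrite !qint//; apply: eq_integral => x _; rewrite /sqrt_average.
  by rewrite opprK addrC.
- move=> f cf bf; rewrite integral_distribution_bounded//.
  have cf2 : continuous (fun x : R => f (x ^+ 2)).
    by move=> x; apply: continuous_comp; [exact: exprn_continuous|exact: cf].
  have bf2 := bounded_fun_comp _ (fun x : R => x ^+ 2) bf.
  have := qmu _ cf2 bf2; apply: cvg_trans; apply: near_eq_cvg; near=> m.
  have m0 : (0 < m)%N by near: m; exact: nbhs_infty_gt.
  rewrite qint// !integral_root_distribution.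
  + congr (_ * _)%:E; apply: eq_big_seq => z.
    rewrite mem_complex_roots ?(monic_of_degree_neq0 _ _ (Qd _ m0))// => zr.
    have := Qp _ m0 _ zr; rewrite lecE => /andP[_ z0].
    by rewrite /sqrt_average sqrrN sqr_sqrtr// mulrDl -splitr.
  + exact: continuous_measurable_RR.
  + apply: continuous_measurable_RR; exact: continuous_sqrt_average.
Unshelve. all: by end_near.
Qed.
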